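(* Let $n\ge 2$ and $q>0$. There is no $u\in C^{6}(\mathbb{R}^{n})$ with $u>0$ solving $\Delta^{3}u=u^{-q}$ in $\mathbb{R}^{n}$ and satisfying $u(x)=o(|x|^{6/(q+1)})$ as $|x|\to+\infty$. Moreover, there is no radially symmetric such solution $u=u(r)$ satisfying $\limsup_{r\to+\infty}u(r)/r^{6/(q+1)}<+\infty$ and $\liminf_{r\to+\infty}u(r)/r^{6/(q+1)}=0$. *)

(* Defs.v *)
From HB Require Import structures.
From mathcomp Require Import all_boot all_order all_algebra.
From mathcomp Require Import all_classical all_reals all_analysis.
Set Implicit Arguments. Unset Strict Implicit. Unset Printing Implicit Defensive.
Import Order.TTheory GRing.Theory Num.Theory.
Import numFieldNormedType.Exports.
Local Open Scope ring_scope.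

Definition evec (R : realType) (n : nat) (i : 'I_n) : 'rV[R]_n :=
  delta_mx 0 i.

Definition partial (R : realType) (n : nat) (i : 'I_n)
  (f : 'rV[R]_n -> R) : 'rV[R]_n -> R :=
  fun x => 'D_(evec R i) f x.

Fixpoint Ck (R : realType) (n : nat) (k : nat) (f : 'rV[R]_n -> R) : Prop :=
  match k with
  | 0 => continuous f
  | k'.+1 => continuous f /\
             (forall (i : 'I_n) (x : 'rV[R]_n), derivable f x (evec R i)) /\
             (forall i : 'I_n, Ck k' (partial i f))
  end.

Definition laplacian (R : realType) (n : nat) (f : 'rV[R]_n -> R) :
  'rV[R]_n -> R :=
  fun x => \sum_(i < n) partial i (partial i f) x.

Definition enorm (R : realType) (n : nat) (x : 'rV[R]_n) : R :=
  Num.sqrt (\sum_(i < n) x 0 i ^+ 2).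

Definition pos_solution (R : realType) (n : nat) (q : R)
  (u : 'rV[R]_n -> R) : Prop :=
  Ck 6 u /\ (forall x, 0 < u x) /\
  (forall x, laplacian (laplacian (laplacian u)) x = u x `^ (- q)).

Definition little_o_pow (R : realType) (n : nat) (a : R)
  (u : 'rV[R]_n -> R) : Prop :=
  forall eps : R, 0 < eps -> exists M : R, forall x : 'rV[R]_n,
    M < enorm x -> `|u x| <= eps * enorm x `^ a.

Definition radial_profile (R : realType) (n : nat) (u : 'rV[R]_n -> R)
  (phi : R -> R) : Prop :=
  forall x, u x = phi (enorm x).

(* Main.v *)
Require Import Defs.
From HB Require Import structures.
From mathcomp Require Import all_boot all_order all_algebra.
From mathcomp Require Import all_classical all_reals all_analysis.
From mathcomp Require Import ring lra.
Import Order.TTheory GRing.Theory Num.Theory.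
Import numFieldNormedType.Exports.
Local Open Scope classical_set_scope.
Local Open Scope ring_scope.

(** If [0 < u <= M] on the ball of radius [rho], then [rho^6 <= C M^(q+1)] with
    [C] depending only on [n]; taking [M = eps rho^(6/(q+1))] this bounds [eps]
    from below. Classically one tests the equation against a cutoff and
    integrates by parts. Here integrals are replaced by finite sums: with
    [T_i] the translation by [h e_i], the operators [A_i = 1 + T_i + ... +
    T_i^(N-1)] are positive, commute, and satisfy [A_i (T_i - 1) = T_i^N - 1], so
    applying [(prod_i A_i^2)^3] to the third power of the discrete Laplacian
    [sum_i (T_i - 1)^2] leaves only a bounded combination of values of [u]. An
    iterated mean value theorem and uniform continuity compare the discrete
    and the true triharmonic operators as [h = L/N] goes to [0].

    For radial [u], put [v = Lap u], [w = Lap v]; [w] is nondecreasing in [r].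
    If [w] is positive somewhere, then [v], hence [u], tends to infinity
    and [u] is eventually nondecreasing. Otherwise [v] is nonincreasing; it is
    nonnegative since [u] would tend to [-oo] if it became negative, so [u] is
    nondecreasing. In both cases [u(r)] is the maximum of [u] on the ball of
    radius [r] for large [r], and the previous bound applies along a sequence
    of radii where [u(r) / r^(6/(q+1))] tends to [0]. *)

(** * Operators generated by translations *)

Definition comb {R : realType} {n : nat} (s : seq (R * 'rV[R]_n))
    (f : 'rV[R]_n -> R) : 'rV[R]_n -> R :=
  fun x => \sum_(p <- s) p.1 * f (x + p.2).

(** The list of weights and shifts is fixed before [f], so these operators form the group algebra of
    the translations of the space, a commutative ring. *)
Definition translation_op {R : realType} {n : nat}
    (T : ('rV[R]_n -> R) -> 'rV[R]_n -> R) : Prop :=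
  exists s, forall f, T f = comb s f.

(** Exchange the two finite sums: shifts add commutatively and weights multiply commutatively. *)
Lemma translation_op_comm {R : realType} {n : nat}
    {T U : ('rV[R]_n -> R) -> 'rV[R]_n -> R} (f : 'rV[R]_n -> R) :
  translation_op T -> translation_op U -> T (U f) = U (T f).
Proof.
move=> [s hT] [t hU]; rewrite !hT !hU; apply/funext => x; rewrite /comb.
under eq_bigr do rewrite mulr_sumr.
rewrite exchange_big /=; apply: eq_bigr => b _.
rewrite mulr_sumr; apply: eq_bigr => a _.
by rewrite mulrCA addrAC.
Qed.

Lemma translation_op_comp {R : realType} {n : nat}
    {T U : ('rV[R]_n -> R) -> 'rV[R]_n -> R} :
  translation_op T -> translation_op U -> translation_op (T \o U).
Proof.
move=> [s hT] [t hU].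
exists [seq (p.1 * r.1, p.2 + r.2) | p <- s, r <- t] => f /=.
rewrite hT hU; apply/funext => x; rewrite /comb big_allpairs_dep /=.
apply: eq_bigr => p _; rewrite mulr_sumr; apply: eq_bigr => r _ /=.
by rewrite mulrA addrA.
Qed.

Lemma translation_op_id (R : realType) (n : nat) :
  translation_op (@id ('rV[R]_n -> R)).
Proof.
exists [:: (1, 0)] => f; apply/funext => x.
by rewrite /comb big_seq1 mul1r addr0.
Qed.

Lemma translation_op_sum {R : realType} {n m : nat}
    (T : 'I_m -> ('rV[R]_n -> R) -> 'rV[R]_n -> R) :
  (forall i, translation_op (T i)) ->
  translation_op (fun f x => \sum_(i < m) T i f x).
Proof.
move=> /choice [s hs]; exists (flatten [seq s i | i <- enum 'I_m]) => f.
apply/funext => x; rewrite /comb big_flatten /= big_map big_enum /=.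
by apply: eq_bigr => i _; rewrite hs.
Qed.

Lemma translation_op_fun_sum {R : realType} {n m : nat}
    {T : ('rV[R]_n -> R) -> 'rV[R]_n -> R} (F : 'I_m -> 'rV[R]_n -> R) :
  translation_op T ->
  T (fun x => \sum_(i < m) F i x) = (fun x => \sum_(i < m) T (F i) x).
Proof.
move=> [s hs]; apply/funext => x; rewrite hs /comb.
under eq_bigr do rewrite mulr_sumr.
by rewrite exchange_big /=; apply: eq_bigr => i _; rewrite hs.
Qed.

(** * Differences, sums over translates and their cancellation *)

Definition fdiff {R : realType} {n : nat} (h : R) (i : 'I_n)
    (f : 'rV[R]_n -> R) : 'rV[R]_n -> R :=
  fun x => f (x + h *: evec R i) - f x.

Definition shift_sum {R : realType} {n : nat} (h : R) (N : nat) (i : 'I_n)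
    (f : 'rV[R]_n -> R) : 'rV[R]_n -> R :=
  fun x => \sum_(s < N) f (x + (s%:R * h) *: evec R i).

(** Squared forward differences, not divided by [h ^+ 2]: a polynomial in the translations that
    behaves like [h ^+ 2] times the Laplacian for small [h]. *)
Definition dlap {R : realType} {n : nat} (h : R) (f : 'rV[R]_n -> R) :
    'rV[R]_n -> R :=
  fun x => \sum_(i < n) fdiff h i (fdiff h i f) x.

(** Each direction is summed twice, to match the squared differences in [dlap]. Keeping [s] a list
    allows one direction to be removed after cancellation. *)
Definition box_sum {R : realType} {n : nat} (h : R) (N : nat) (s : seq 'I_n)
    (f : 'rV[R]_n -> R) : 'rV[R]_n -> R :=
  foldr (fun i g => shift_sum h N i (shift_sum h N i g)) f s.

Lemma translation_op_fdiff {R : realType} {n : nat} (h : R) (i : 'I_n) :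
  translation_op (fdiff h i).
Proof.
exists [:: (1, h *: evec R i); (-1, 0)] => f; apply/funext => x.
by rewrite /comb big_cons big_seq1 /= mul1r mulN1r addr0.
Qed.

Lemma translation_op_shift_sum {R : realType} {n : nat} (h : R) N (i : 'I_n) :
  translation_op (shift_sum h N i).
Proof.
apply: translation_op_sum => s.
exists [:: (1, (s%:R * h) *: evec R i)] => f; apply/funext => x.
by rewrite /comb big_seq1 /= mul1r.
Qed.

Lemma translation_op_dlap {R : realType} {n : nat} (h : R) :
  translation_op (@dlap R n h).
Proof.
by apply: translation_op_sum => i;
  apply: translation_op_comp; apply: translation_op_fdiff.
Qed.

Lemma translation_op_box_sum {R : realType} {n : nat} (h : R) N (s : seq 'I_n) :
  translation_op (box_sum h N s).
Proof.
elim: s => [|i s ih]; first exact: translation_op_id.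
apply: (@translation_op_comp R n _ _ (translation_op_shift_sum h N i)).
exact: translation_op_comp (translation_op_shift_sum h N i) ih.
Qed.

(** Telescoping, as in [(1 + T + ... + T^(N-1)) (T - 1) = T^N - 1]. *)
Lemma shift_sum_fdiff {R : realType} {n : nat} (h : R) N (i : 'I_n)
    (f : 'rV[R]_n -> R) :
  shift_sum h N i (fdiff h i f) = fdiff (N%:R * h) i f.
Proof.
apply/funext => x; rewrite /shift_sum /fdiff.
pose F k := f (x + (k%:R * h) *: evec R i).
transitivity (\sum_(0 <= k < N) (F k.+1 - F k)).
  rewrite big_mkord; apply: eq_bigr => k _; rewrite /F.
  by rewrite -addrA -scalerDl -natr1 mulrDl mul1r.
by rewrite telescope_sumr // /F mul0r scale0r addr0.
Qed.

Lemma shift_sum2_fdiff2 {R : realType} {n : nat} (h : R) N (i : 'I_n)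
    (f : 'rV[R]_n -> R) :
  shift_sum h N i (shift_sum h N i (fdiff h i (fdiff h i f))) =
  fdiff (N%:R * h) i (fdiff (N%:R * h) i f).
Proof.
rewrite shift_sum_fdiff.
by rewrite (translation_op_comm _ (translation_op_shift_sum h N i)
  (translation_op_fdiff _ i)) shift_sum_fdiff.
Qed.

(** The double sum in direction [i] is moved next to the second difference, and the two collapse;
    the sums that remain carry two fewer factors [N]. *)
Lemma box_sum_fdiff2 {R : realType} {n : nat} (h : R) N (i : 'I_n) s
    (f : 'rV[R]_n -> R) : i \in s ->
  box_sum h N s (fdiff h i (fdiff h i f)) =
  box_sum h N (rem i s) (fdiff (N%:R * h) i (fdiff (N%:R * h) i f)).
Proof.
elim: s => [//|j s ih]; rewrite inE; have [->{j} _|/= ij /ih ihs] := eqVneq j i.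
  rewrite /= eqxx.
  have cm g := translation_op_comm g (translation_op_shift_sum h N i)
    (translation_op_box_sum h N s).
  by rewrite !cm shift_sum2_fdiff2.
by rewrite (negPf ij) /= ihs.
Qed.

(** * Bounds for the operators on sup-norm balls *)

Lemma norm_evec {R : realType} {n : nat} (i : 'I_n) : `|evec R i| <= 1 :> R.
Proof.
rewrite /evec [leLHS]/Num.Def.normr /= mx_normrE; apply/bigmax_leP; split => //= -[a b] _.
by rewrite mxE; case: (_ && _); rewrite ?normr1 ?normr0.
Qed.

Lemma norm_scale_evec {R : realType} {n : nat} (i : 'I_n) (c d : R) :
  0 <= c <= d -> `|c *: evec R i| <= d.
Proof.
move=> /andP[c0 cd]; rewrite normrZ ger0_norm //.
by rewrite (le_trans _ cd) // ler_piMr // norm_evec.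
Qed.

Lemma norm_add_scale_evec {R : realType} {n : nat} (i : 'I_n) (c d K : R) x :
  0 <= c <= d -> `|x| <= K -> `|x + c *: evec R i| <= K + d.
Proof.
move=> cd xK; rewrite (le_trans (ler_normD _ _)) // lerD //.
exact: norm_scale_evec.
Qed.

Lemma shift_sum_ge {R : realType} {n : nat} {h K m : R} N (i : 'I_n)
    (f : 'rV[R]_n -> R) : 0 <= h ->
  (forall x, `|x| <= K + N%:R * h -> m <= f x) ->
  forall x, `|x| <= K -> N%:R * m <= shift_sum h N i f x.
Proof.
move=> h0 fm x xK; rewrite /shift_sum.
have -> : N%:R * m = \sum_(s < N) m by rewrite sumr_const card_ord mulr_natl.
apply: ler_sum => s _; apply: fm; apply: norm_add_scale_evec => //.
by rewrite mulr_ge0 //= ler_wpM2r // ler_nat ltnW.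
Qed.

Lemma shift_sum_le {R : realType} {n : nat} {h K M : R} N (i : 'I_n)
    (f : 'rV[R]_n -> R) : 0 <= h ->
  (forall x, `|x| <= K + N%:R * h -> `|f x| <= M) ->
  forall x, `|x| <= K -> `|shift_sum h N i f x| <= N%:R * M.
Proof.
move=> h0 fm x xK; rewrite /shift_sum (le_trans (ler_norm_sum _ _ _)) //.
have -> : N%:R * M = \sum_(s < N) M by rewrite sumr_const card_ord mulr_natl.
apply: ler_sum => s _; apply: fm; apply: norm_add_scale_evec => //.
by rewrite mulr_ge0 //= ler_wpM2r // ler_nat ltnW.
Qed.

(** All coefficients are nonnegative. Every index contributes two sums, each of total weight [N] and
    each enlarging the ball by at most [N%:R * h]. *)
Lemma box_sum_ge {R : realType} {n : nat} {h K m : R} N (s : seq 'I_n)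
    (f : 'rV[R]_n -> R) : 0 <= h ->
  (forall x, `|x| <= K + (2 * size s)%:R * (N%:R * h) -> m <= f x) ->
  forall x, `|x| <= K -> N%:R ^+ (2 * size s) * m <= box_sum h N s f x.
Proof.
move=> h0; elim: s K => [|i s ih] K fm x xK.
  by rewrite muln0 expr0 mul1r; apply: fm; rewrite muln0 mul0r addr0.
rewrite mulnS exprD expr2 -!mulrA /=.
apply: (shift_sum_ge (K := K)) => // {xK}x xK.
apply: (shift_sum_ge (K := K + N%:R * h)) => // {xK}x xK.
apply: (ih (K + N%:R * h + N%:R * h)) => // {xK}x xK; apply: fm => /=.
move: xK; rewrite mulnS natrD mulrDl; congr (_ <= _); ring.
Qed.

Lemma box_sum_le {R : realType} {n : nat} {h K M : R} N (s : seq 'I_n)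
    (f : 'rV[R]_n -> R) : 0 <= h ->
  (forall x, `|x| <= K + (2 * size s)%:R * (N%:R * h) -> `|f x| <= M) ->
  forall x, `|x| <= K -> `|box_sum h N s f x| <= N%:R ^+ (2 * size s) * M.
Proof.
move=> h0; elim: s K => [|i s ih] K fm x xK.
  by rewrite muln0 expr0 mul1r; apply: fm; rewrite muln0 mul0r addr0.
rewrite mulnS exprD expr2 -!mulrA /=.
apply: (shift_sum_le (K := K)) => // {xK}x xK.
apply: (shift_sum_le (K := K + N%:R * h)) => // {xK}x xK.
apply: (ih (K + N%:R * h + N%:R * h)) => // {xK}x xK; apply: fm => /=.
move: xK; rewrite mulnS natrD mulrDl; congr (_ <= _); ring.
Qed.

Lemma fdiff_le {R : realType} {n : nat} {h K M : R} (i : 'I_n)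
    (f : 'rV[R]_n -> R) : 0 <= h ->
  (forall x, `|x| <= K + h -> `|f x| <= M) ->
  forall x, `|x| <= K -> `|fdiff h i f x| <= 2 * M.
Proof.
move=> h0 fM x xK; rewrite /fdiff (le_trans (ler_normB _ _)) //.
rewrite mulr_natl mulr2n lerD // fM //; first last.
  by rewrite (le_trans xK) // lerDl.
by apply: norm_add_scale_evec => //; rewrite h0 lexx.
Qed.

(** The gain over the trivial bound is the exponent [2 * n.-1] in place of [2 * n]: in each of the
    [n] directions a double sum cancels, leaving two differences of step [N%:R * h], each costing a
    factor 2. *)
Lemma box_sum_dlap_le {R : realType} {n : nat} {h K M : R} N
    (f : 'rV[R]_n -> R) : 0 <= h ->
  (forall x, `|x| <= K + (2 * n)%:R * (N%:R * h) -> `|f x| <= M) ->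
  forall x, `|x| <= K ->
  `|box_sum h N (enum 'I_n) (dlap h f) x| <=
    (4 * n)%:R * N%:R ^+ (2 * n.-1) * M.
Proof.
move=> h0 fM x xK.
rewrite (translation_op_fun_sum _ (translation_op_box_sum h N _)).
rewrite (le_trans (ler_norm_sum _ _ _)) //.
suff bi (i : 'I_n) : `|box_sum h N (enum 'I_n) (fdiff h i (fdiff h i f)) x| <=
    4 * N%:R ^+ (2 * n.-1) * M.
  rewrite (le_trans (ler_sum _ (fun i _ => bi i))) // sumr_const card_ord.
  rewrite -mulr_natl natrM; rewrite le_eqVlt; apply/orP; left; apply/eqP; ring.
have n0 : (0 < n)%N by apply: leq_ltn_trans (ltn_ord i).
have iE : i \in enum 'I_n by rewrite mem_enum.
have sz : size (rem i (enum 'I_n)) = n.-1 by rewrite size_rem // size_enum_ord.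
rewrite box_sum_fdiff2 // -sz -mulrA mulrCA.
apply: (box_sum_le (K := K)) => // {xK}x xK.
have Nh0 : 0 <= N%:R * h by rewrite mulr_ge0.
have -> : 4 * M = 2 * (2 * M) by ring.
apply: fdiff_le xK => // {}x xK; apply: fdiff_le xK => // {}x xK; apply: fM.
have -> : (2 * n)%:R = (2 * n.-1)%:R + 2%:R :> R.
  by rewrite -natrD -mulnSr prednK.
by move: xK; rewrite sz; congr (_ <= _); ring.
Qed.

(** Three box sums are applied and evaluated at the origin. Positivity bounds the result below,
    cancellation bounds it above; each box sum enlarges the ball by [(2 * n)%:R * (N%:R * h)],
    whence the radius. *)
Lemma dlap3_le {R : realType} {n : nat} (h M m : R) N (f : 'rV[R]_n -> R) :
  (0 < n)%N -> (0 < N)%N -> 0 <= h ->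
  (forall x, `|x| <= (6 * n)%:R * (N%:R * h) -> `|f x| <= M) ->
  (forall x, `|x| <= (6 * n)%:R * (N%:R * h) -> m <= dlap h (dlap h (dlap h f)) x) ->
  N%:R ^+ 6 * m <= 64 * n%:R ^+ 3 * M.
Proof.
move=> n0 N0 h0 fM fm.
set L := N%:R * h; have L0 : 0 <= L by rewrite mulr_ge0.
pose B := @box_sum R n h N (enum 'I_n).
have cm g : B (dlap h g) = dlap h (B g).
  by apply: translation_op_comm; [exact: translation_op_box_sum|
     exact: translation_op_dlap].
(* Interleaving pairs every discrete Laplacian with its own box sum. *)
have E : B (B (B (dlap h (dlap h (dlap h f))))) =
    B (dlap h (B (dlap h (B (dlap h f))))) by rewrite !cm.
pose k := (2 * n)%:R * L.
have k0 : 0 <= k by rewrite mulr_ge0.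
have k3 : (6 * n)%:R * L = k + k + k by rewrite /k !natrM; ring.
have z0 : `|0 : 'rV[R]_n| <= 0 by rewrite normr0.
have lo : N%:R ^+ (2 * n) * (N%:R ^+ (2 * n) * (N%:R ^+ (2 * n) * m)) <=
    B (B (B (dlap h (dlap h (dlap h f))))) 0.
  have ge K c g := @box_sum_ge R n h K c N (enum 'I_n) g h0.
  rewrite size_enum_ord -/k in ge.
  apply: (ge 0) => // x; rewrite add0r => xK.
  apply: (ge k) xK => {}x xK; apply: (ge (k + k)) xK => {}x xK.
  by apply: fm; rewrite k3.
pose C : R := (4 * n)%:R * N%:R ^+ (2 * n.-1).
have up : `|B (dlap h (B (dlap h (B (dlap h f))))) 0| <= C * (C * (C * M)).
  apply: (box_sum_dlap_le (K := 0)) => // x; rewrite add0r -/k => xK.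
  apply: (box_sum_dlap_le (K := k)) xK => // {}x; rewrite -/k => xK.
  apply: (box_sum_dlap_le (K := k + k)) xK => // {}x; rewrite -/k => xK.
  by apply: fM; rewrite k3.
have := le_trans lo (le_trans (ler_norm _) (_ : _ <= C * (C * (C * M)))).
rewrite E => /(_ up).
(* Each lower factor is [N ^ 2] times the power of [N] occurring in [C]; cancelling [P ^+ 3] leaves
   [N ^ 6] against [(4 n)^3 = 64 n^3]. *)
have -> : (2 * n = 2 + 2 * n.-1)%N by rewrite -mulnS prednK.
rewrite /C exprD; set P := N%:R ^+ (2 * n.-1); rewrite !natrM.
have P0 : 0 < P ^+ 3 by rewrite exprn_gt0 // exprn_gt0 // ltr0n.
move=> H; rewrite -(ler_pM2r P0); move: H; congr (_ <= _); ring.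
Qed.

(** * Discrete and true Laplacians *)

Lemma is_derive_line {R : realType} {n : nat} (f : 'rV[R]_n -> R) x v (t d : R) :
  is_derive (x + t *: v) v f d <-> is_derive t 1 (fun s => f (x + s *: v)) d.
Proof.
have E : (fun h : R => h^-1 *: ((f \o shift (x + t *: v)) (h *: v) -
                                f (x + t *: v))) =
  (fun h : R => h^-1 *: (((fun s => f (x + s *: v)) \o shift t) (h *: 1) -
                                f (x + t *: v))).
  apply/funext => h /=; congr (_ *: (f _ - _)).
  by rewrite [h *: 1]mulr1 scalerDl addrCA.
have D : derivable f (x + t *: v) v = derivable (fun s : R => f (x + s *: v)) t 1.
  by rewrite /derivable E.
have V : 'D_v f (x + t *: v) = 'D_1 (fun s : R => f (x + s *: v)) t.
  by rewrite /derive E.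
split => -[dv <-].
  by apply: DeriveDef; [rewrite -D|exact: esym V].
by apply: DeriveDef; [rewrite D|exact: V].
Qed.

Lemma is_derive_line0 {R : realType} {n : nat} (f : 'rV[R]_n -> R) x v (d : R) :
  is_derive x v f d <-> is_derive (0 : R) 1 (fun s => f (x + s *: v)) d.
Proof.
by split => [df|/is_derive_line]; [apply/is_derive_line|]; rewrite scale0r addr0.
Qed.

Lemma is_derive_partial {R : realType} {n : nat} (i : 'I_n) (f : 'rV[R]_n -> R) :
  (forall x, derivable f x (evec R i)) ->
  forall x (t : R), is_derive t 1 (fun s => f (x + s *: evec R i))
    (partial i f (x + t *: evec R i)).
Proof. by move=> df x t; apply/is_derive_line; apply: derivableP. Qed.

Lemma MVT_global {R : realType} (g dg : R -> R) (a b : R) : a < b ->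
  (forall x : R, is_derive x 1 g (dg x)) ->
  exists2 c, a < c < b & g b - g a = dg c * (b - a).
Proof.
move=> ab dgP; have [|c] := @MVT R g dg a b ab (fun x _ => dgP x).
  by apply: derivable_within_continuous => x _; have [] := dgP x.
by rewrite in_itv /=; exists c.
Qed.

Lemma fdiff_mvt {R : realType} {n : nat} (h : R) (i : 'I_n) (f : 'rV[R]_n -> R) x :
  0 < h -> (forall x, derivable f x (evec R i)) ->
  exists2 c, 0 < c < h & fdiff h i f x = h * partial i f (x + c *: evec R i).
Proof.
move=> h0 df.
have [c ch] := MVT_global _ _ _ _ h0 (is_derive_partial i f df x).
rewrite subr0 scale0r addr0 => E; exists c => //.
by rewrite /fdiff E mulrC.
Qed.

(** Differences commute with partial derivatives, since translations do. *)
Lemma is_derive_fdiff {R : realType} {n : nat} (h : R) (i j : 'I_n)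
    (f : 'rV[R]_n -> R) :
  (forall x, derivable f x (evec R i)) ->
  forall x, is_derive x (evec R i) (fdiff h j f) (fdiff h j (partial i f) x).
Proof.
move=> df x; apply/is_derive_line0; rewrite /fdiff; apply: is_deriveB.
  have -> : (fun s : R => f (x + s *: evec R i + h *: evec R j)) =
    (fun s : R => f (x + h *: evec R j + s *: evec R i)).
    by apply/funext => s; rewrite addrAC.
  by have := is_derive_partial i f df (x + h *: evec R j) 0; rewrite scale0r addr0.
by have := is_derive_partial i f df x 0; rewrite scale0r addr0.
Qed.

(** * Calculus of functions of class [Ck] *)

Lemma CkW {R : realType} {n k : nat} {f : 'rV[R]_n -> R} : Ck k.+1 f -> Ck k f.
Proof.
elim: k f => [|k ih] f; first by case.
by move=> [cf [df pf]]; split => //; split => // i; apply: ih; apply: pf.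
Qed.

Lemma Ck_continuous {R : realType} {n : nat} {k} {f : 'rV[R]_n -> R} :
  Ck k f -> continuous f.
Proof. by case: k => [//|k []]. Qed.

Lemma Ck_derivable {R : realType} {n : nat} {k} {f : 'rV[R]_n -> R} :
  Ck k.+1 f -> forall i x, derivable f x (evec R i).
Proof. by move=> [_ []]. Qed.

Lemma Ck_partial {R : realType} {n : nat} {k} {f : 'rV[R]_n -> R} :
  Ck k.+1 f -> forall i, Ck k (partial i f).
Proof. by move=> [_ []]. Qed.

Lemma sum_funE {R : realType} {T : Type} {m : nat} (F : 'I_m -> T -> R) :
  (fun x => \sum_(j < m) F j x) = \sum_(j < m) F j.
Proof. by apply/funext => x; rewrite fct_sumE. Qed.

Lemma partial_sum {R : realType} {n m : nat} (i : 'I_n)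
    (F : 'I_m -> 'rV[R]_n -> R) :
  (forall j x, derivable (F j) x (evec R i)) ->
  partial i (fun x => \sum_(j < m) F j x) = (fun x => \sum_(j < m) partial i (F j) x).
Proof.
move=> dF; apply/funext => x; rewrite /partial -derive_sum.
  by rewrite sum_funE.
by move=> j; apply: dF.
Qed.

Lemma Ck_sum {R : realType} {n m : nat} k (F : 'I_m -> 'rV[R]_n -> R) :
  (forall j, Ck k (F j)) -> Ck k (fun x => \sum_(j < m) F j x).
Proof.
have cs (G : 'I_m -> 'rV[R]_n -> R) : (forall j, continuous (G j)) ->
    continuous (fun x => \sum_(j < m) G j x).
  by move=> cG; apply: continuous_big => //; exact: add_continuous.
elim: k F => [|k ih] F cF; first exact: cs.
split; first by apply: cs => j; apply: Ck_continuous (cF j).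
split => [i x|i].
  rewrite sum_funE; apply: derivable_sum => j.
  exact: Ck_derivable (cF j) i x.
rewrite partial_sum; last by move=> j; exact: Ck_derivable (cF j) i.
by apply: ih => j; apply: Ck_partial.
Qed.

Lemma Ck_laplacian {R : realType} {n k : nat} {f : 'rV[R]_n -> R} :
  Ck k.+2 f -> Ck k (laplacian f).
Proof.
by move=> cf; apply: Ck_sum => i; do 2 apply: Ck_partial.
Qed.

Lemma laplacian_sum {R : realType} {n m : nat} (F : 'I_m -> 'rV[R]_n -> R) :
  (forall j, Ck 2 (F j)) ->
  laplacian (fun x => \sum_(j < m) F j x) = (fun x => \sum_(j < m) laplacian (F j) x).
Proof.
move=> cF; apply/funext => x; rewrite /laplacian exchange_big /=.
apply: eq_bigr => i _; rewrite partial_sum; last first.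
  by move=> j; exact: Ck_derivable (cF j) i.
rewrite partial_sum // => j.
by have /Ck_derivable/(_ i) := Ck_partial (cF j) i.
Qed.

Definition fdiffs {R : realType} {n : nat} (h : R) (l : seq 'I_n)
    (f : 'rV[R]_n -> R) : 'rV[R]_n -> R := foldr (fdiff h) f l.

(** The head of [l] is differentiated first, whereas in [fdiffs] it is the outermost difference: the
    mean value theorem turns the outermost difference into the innermost derivative. *)
Definition partials {R : realType} {n : nat} (l : seq 'I_n)
    (f : 'rV[R]_n -> R) : 'rV[R]_n -> R := foldl (fun g i => partial i g) f l.

Lemma is_derive_fdiffs {R : realType} {n : nat} (h : R) (i : 'I_n) l
    (f : 'rV[R]_n -> R) :
  (forall x, derivable f x (evec R i)) ->
  forall x, is_derive x (evec R i) (fdiffs h l f) (fdiffs h l (partial i f) x).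
Proof.
move=> df; elim: l => [|j l ih] x; first exact: derivableP.
have -> : fdiffs h (j :: l) (partial i f) =
    fdiff h j (partial i (fdiffs h l f)).
  congr (fdiff h j _); apply/funext => y.
  by rewrite /partial; apply/esym; apply: derive_val.
by apply: is_derive_fdiff => y; apply: ex_derive.
Qed.

Lemma Ck_partials {R : realType} {n : nat} l k (f : 'rV[R]_n -> R) :
  Ck (size l + k) f -> Ck k (partials l f).
Proof. by elim: l f => [//|i l ih] f cf; apply: ih; apply: Ck_partial. Qed.

(** The mean value theorem is applied to the outermost difference, the resulting derivative passes
    through the other differences onto [f], and induction applies to [partial i f]. Each step moves
    the point by at most [h]. *)
Lemma fdiffs_mvt {R : realType} {n : nat} (h : R) l (f : 'rV[R]_n -> R) x :
  0 < h -> Ck (size l) f ->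
  exists2 y, `|y - x| <= (size l)%:R * h &
    fdiffs h l f x = h ^+ size l * partials l f y.
Proof.
move=> h0; elim: l f x => [|i l ih] f x cf.
  by exists x; [rewrite subrr normr0 mul0r|rewrite mul1r].
have df := Ck_derivable cf i.
have [|c ch E] := @fdiff_mvt R n h i (fdiffs h l f) x h0.
  by move=> y; have [] := is_derive_fdiffs h i l f df y.
have [y yx Ey] := ih (partial i f) (x + c *: evec R i) (Ck_partial cf i).
exists y.
  rewrite -(subrKA (x + c *: evec R i)) (le_trans (ler_normD _ _)) //=.
  rewrite addrAC subrr add0r -natr1 mulrDl mul1r lerD //.
  by apply: norm_scale_evec; case/andP: ch => /ltW -> /ltW ->.
rewrite [LHS]E exprS -mulrA -Ey; congr (_ * _).
by have [_ <-] := is_derive_fdiffs h i l f df (x + c *: evec R i).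
Qed.

Lemma dlap3E {R : realType} {n : nat} (h : R) (f : 'rV[R]_n -> R) x :
  dlap h (dlap h (dlap h f)) x =
  \sum_(i < n) \sum_(j < n) \sum_(k < n) fdiffs h [:: k; k; j; j; i; i] f x.
Proof.
have S (F : 'I_n -> 'rV[R]_n -> R) :
    dlap h (fun x => \sum_(i < n) F i x) = (fun x => \sum_(i < n) dlap h (F i) x).
  by apply: translation_op_fun_sum; apply: translation_op_dlap.
rewrite {3}/dlap S S; apply: eq_bigr => i _.
by rewrite {2}/dlap S.
Qed.

(** Reconciles the order of derivatives produced by expanding the iterated Laplacian with the order
    produced by [fdiffs_mvt]. *)
Lemma sum3_rev {V : nmodType} {n : nat} (a : 'I_n -> 'I_n -> 'I_n -> V) :
  \sum_(i < n) \sum_(j < n) \sum_(k < n) a i j k =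
  \sum_(i < n) \sum_(j < n) \sum_(k < n) a k j i.
Proof.
rewrite exchange_big; under eq_bigr do rewrite exchange_big.
by rewrite exchange_big.
Qed.

Lemma sum3_affine {R : pzRingType} {n : nat} (c b : R)
    (a : 'I_n -> 'I_n -> 'I_n -> R) :
  \sum_(i < n) \sum_(j < n) \sum_(k < n) c * (a i j k - b) =
  c * (\sum_(i < n) \sum_(j < n) \sum_(k < n) a i j k - b *+ (n * n * n)).
Proof.
have H F d : \sum_(i < n) c * (F i - d) = c * (\sum_(i < n) F i - d *+ n).
  by rewrite -mulr_sumr sumrB sumr_const card_ord.
rewrite !mulrnA -!H; apply: eq_bigr => i _.
by rewrite -H; apply: eq_bigr => j _; rewrite H.
Qed.

Lemma laplacian3E {R : realType} {n : nat} (f : 'rV[R]_n -> R) x : Ck 6 f ->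
  laplacian (laplacian (laplacian f)) x =
  \sum_(i < n) \sum_(j < n) \sum_(k < n) partials [:: k; k; j; j; i; i] f x.
Proof.
move=> cf.
have L (g : 'rV[R]_n -> R) :
  laplacian g = (fun x => \sum_(i < n) partials [:: i; i] g x) by [].
have c4 i : Ck 4 (partials [:: i; i] f) by exact: Ck_partials.
have c2 i j : Ck 2 (partials [:: j; j] (partials [:: i; i] f)).
  by apply: Ck_partials; exact: c4.
have s2 : laplacian (laplacian f) =
    (fun x => \sum_(i < n) laplacian (partials [:: i; i] f) x).
  by rewrite (L f); apply: laplacian_sum => i; exact: CkW (CkW (c4 i)).
have s4 : laplacian (fun x => \sum_(i < n) laplacian (partials [:: i; i] f) x) =
    (fun x => \sum_(i < n) laplacian (laplacian (partials [:: i; i] f)) x).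
  by apply: laplacian_sum => i; exact: Ck_laplacian (c4 i).
have E : laplacian (laplacian (laplacian f)) =
    (fun x => \sum_(i < n) laplacian (laplacian (partials [:: i; i] f)) x).
  exact: etrans (congr1 (@laplacian R n) s2) s4.
rewrite E -(sum3_rev (fun i j k => partials [:: i; i; j; j; k; k] f x)).
apply: eq_bigr => i _.
by rewrite (L (partials [:: i; i] f)) (laplacian_sum _ (c2 i)).
Qed.

(** * Uniform comparison on compact balls *)

Lemma compact_norm_le {R : realType} (n : nat) (K : R) :
  compact [set x : 'rV[R]_n | `|x| <= K].
Proof.
apply: bounded_closed_compact; last first.
  by apply: (@closed_comp _ _ (@Num.norm R 'rV[R]_n) [set r | r <= K]);
    [move=> x _; exact: norm_continuous|exact: closed_le].
exists K; split; first exact: num_real.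
by move=> M KM x /= xK; rewrite (le_trans xK) // ltW.
Qed.

Lemma unif_continuous_ball {R : realType} {n : nat} (g : 'rV[R]_n -> R) (K e : R) :
  continuous g -> 0 < e ->
  \forall d \near 0^'+, forall x, `|x| <= K ->
    forall y, `|y - x| <= d -> `|g y - g x| <= e.
Proof.
move=> cg e0.
move/compact_near_coveringP : (compact_norm_le n K) => /(_ _ (0^'+ : set_system R)
  (fun d x => forall y, `|y - x| <= d -> `|g y - g x| <= e)); apply => x _.
have e2 : 0 < e / 2 by rewrite divr_gt0.
have /cvgrPdist_lt/(_ _ e2) /nbhs_ballP[r /= r0 xr] := cg x.
have r2 : 0 < r / 2 by rewrite divr_gt0.
have gx y : `|y - x| < r -> `|g y - g x| < e / 2.
  move=> yx; rewrite distrC; apply: xr.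
  by rewrite -ball_normE /= distrC.
(* Half of the radius is spent on moving the centre from [x] to [z], half on the distance from [z]
   to [y]; both values are then compared with [g x]. *)
exists (ball x (r / 2), [set d | d < r / 2]) => /=.
  split; first exact: nbhsx_ballx.
  exact: nbhs_right_lt.
move=> [z d] /= []; rewrite -ball_normE /= distrC => zx dr y yz.
rewrite -(subrKA (g x)) (le_trans (ler_normD _ _)) // [e]splitr lerD //.
  apply/ltW/gx; rewrite -(subrKA z) (le_lt_trans (ler_normD _ _)) //.
  by rewrite [r]splitr ltrD // (le_lt_trans yz).
by rewrite distrC; apply/ltW/gx; rewrite (lt_trans zx) // ltr_pdivrMr // ltr_pMr // ltr1n.
Qed.

(** Both sides expand over triples of indices; [fdiffs_mvt] matches the terms up to an evaluation at
    a nearby point, controlled by uniform continuity of the sixth derivatives. *)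
Lemma dlap3_ge {R : realType} {n : nat} (f : 'rV[R]_n -> R) (K e : R) :
  Ck 6 f -> 0 < e ->
  \forall h \near 0^'+, forall x, `|x| <= K ->
    h ^+ 6 * (laplacian (laplacian (laplacian f)) x - e) <=
    dlap h (dlap h (dlap h f)) x.
Proof.
move=> cf e0.
pose T := ('I_n * 'I_n * 'I_n)%type.
pose l (t : T) := [:: t.2; t.2; t.1.2; t.1.2; t.1.1; t.1.1].
(* One more than the number of triples: [c] is positive for every [n], and the errors [e / c] add up
   to at most [e]. *)
pose c : R := (n * n * n).+1%:R.
have c0 : 0 < c by rewrite ltr0n.
have ec : 0 < e / c by rewrite divr_gt0.
have near1 : \forall d \near 0^'+, forall t : T, forall x, `|x| <= K ->
    forall y, `|y - x| <= d ->
    `|partials (l t) f y - partials (l t) f x| <= e / c.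
  apply: filter_forall => t; apply: unif_continuous_ball => //.
  by apply: (@Ck_continuous _ _ 0); apply: Ck_partials.
have [d /= d0 dP] := near1.
have d6 : 0 < d / 6 by rewrite divr_gt0.
near=> h => x xK.
have h0 : 0 < h by [].
(* Six mean value steps move the point by at most [6 * h]. *)
have h6 : 6 * h < d.
  by rewrite mulrC -ltr_pdivlMr //; near: h; exact: nbhs_right_lt.
have term (t : T) : h ^+ 6 * (partials (l t) f x - e / c) <= fdiffs h (l t) f x.
  have [y yx ->] := fdiffs_mvt h (l t) f x h0 cf.
  rewrite ler_pM2l ?exprn_gt0 // lerBlDr -lerBlDl.
  have /dP/(_ _ t x xK y yx) : ball (0 : R) d (6 * h).
    by rewrite -ball_normE /= sub0r normrN gtr0_norm // mulr_gt0.
  rewrite mulr_gt0 // distrC => /(_ isT); apply: le_trans; exact: ler_norm.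
rewrite dlap3E laplacian3E //.
apply: (@le_trans _ _ (\sum_(i < n) \sum_(j < n) \sum_(k < n)
    h ^+ 6 * (partials (l (i, j, k)) f x - e / c))); last first.
  by apply: ler_sum => i _; apply: ler_sum => j _; apply: ler_sum => k _;
    exact: (term (i, j, k)).
rewrite sum3_affine ler_pM2l ?exprn_gt0 //.
rewrite lerB // -mulr_natr mulrAC ler_pdivrMr // ler_pM2l //.
by rewrite ler_nat.
Unshelve. all: by end_near. Qed.

(** * Growth of positive solutions *)

Lemma norm_coord_le {R : realType} {n : nat} (x : 'rV[R]_n) i : `|x 0 i| <= `|x|.
Proof.
rewrite [leRHS]/Num.Def.normr /= mx_normrE; apply/bigmax_geP; right => /=.
by exists (0, i).
Qed.

Lemma enorm_ge0 {R : realType} {n : nat} (x : 'rV[R]_n) : 0 <= enorm x.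
Proof. exact: sqrtr_ge0. Qed.

Lemma enorm_sqr {R : realType} {n : nat} (x : 'rV[R]_n) :
  enorm x ^+ 2 = \sum_(i < n) x 0 i ^+ 2.
Proof. by rewrite sqr_sqrtr // sumr_ge0 // => i _; rewrite sqr_ge0. Qed.

Lemma enorm_le_norm {R : realType} {n : nat} (x : 'rV[R]_n) :
  enorm x <= n%:R * `|x|.
Proof.
rewrite -(ler_pXn2r (ltn0Sn 1)) ?nnegrE ?enorm_ge0 ?mulr_ge0 // enorm_sqr.
have le1 i : x 0 i ^+ 2 <= `|x| ^+ 2.
  by rewrite -[leLHS]ger0_norm ?sqr_ge0 // normrX lerXn2r ?nnegrE // norm_coord_le.
rewrite (le_trans (ler_sum _ (fun i _ => le1 i))) // sumr_const card_ord.
rewrite -[leLHS]mulr_natl exprMn ler_wpM2r ?sqr_ge0 // expr2 -natrM ler_nat.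
by case: (n) => // k; rewrite leq_pmulr.
Qed.

Lemma norm_le_enorm {R : realType} {n : nat} (x : 'rV[R]_n) : `|x| <= enorm x.
Proof.
rewrite [leLHS]/Num.Def.normr /= mx_normrE; apply/bigmax_leP.
split=> [|[a i] _ /=]; first exact: enorm_ge0.
rewrite (ord1 a) -(ler_pXn2r (ltn0Sn 1)) ?nnegrE ?enorm_ge0 // enorm_sqr.
rewrite -normrX ger0_norm ?sqr_ge0 // (bigD1 i) //= lerDl.
by rewrite sumr_ge0 // => j _; rewrite sqr_ge0.
Qed.

(** The discrete estimate with [h = L / N]: the powers of [N] and [h] combine into [L ^+ 6].
    Conceding [m / 2] to the discretisation error doubles the constant 64. *)
Lemma laplacian3_le {R : realType} {n : nat} (u : 'rV[R]_n -> R) (L M m : R) :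
  (0 < n)%N -> Ck 6 u -> 0 < L -> 0 < m ->
  (forall x, `|x| <= (6 * n)%:R * L -> `|u x| <= M) ->
  (forall x, `|x| <= (6 * n)%:R * L -> m <= laplacian (laplacian (laplacian u)) x) ->
  L ^+ 6 * m <= 128 * n%:R ^+ 3 * M.
Proof.
move=> n0 cu L0 m0 uM um.
have m2 : 0 < m / 2 by rewrite divr_gt0.
have [d /= d0 dP] := @dlap3_ge R n u ((6 * n)%:R * L) (m / 2) cu m2.
(* Large enough for the step [L / N] to fall below the threshold [d]. *)
pose N := (Num.bound (L / d)).+1.
have N0 : 0 < N%:R :> R by rewrite ltr0n.
pose h := L / N%:R.
have h0 : 0 < h by rewrite divr_gt0.
have NhL : N%:R * h = L by rewrite mulrC divfK // gt_eqF.
have hd : h < d.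
  rewrite ltr_pdivrMr // mulrC -ltr_pdivrMr //.
  rewrite (lt_le_trans (archi_boundP _)) ?ler_nat //.
  by rewrite divr_ge0 // ltW.
have bh : ball (0 : R) d h by rewrite -ball_normE /= sub0r normrN gtr0_norm.
have := @dlap3_le R n h M (h ^+ 6 * (m / 2)) N u n0 isT (ltW h0).
rewrite NhL => /(_ uM) H.
have {}H : N%:R ^+ 6 * (h ^+ 6 * (m / 2)) <= 64 * n%:R ^+ 3 * M.
  apply: H => x xK; apply: le_trans (dP h bh h0 x xK).
  rewrite ler_pM2l ?exprn_gt0 //.
  by have := um x xK; lra.
rewrite mulrA -exprMn NhL in H.
by move: H; lra.
Qed.

(** Where [u] is at most [M], its triharmonic Laplacian is at least [M] to the power [- q]. The
    choice [L = rho / (6 n^2)] fits the sup-norm ball of radius [6 n L] into the Euclidean ball of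
    radius [rho], because [enorm] is at most [n] times the sup norm. *)
Lemma solution_growth {R : realType} {n : nat} (q : R) (u : 'rV[R]_n -> R)
    (rho M : R) :
  (0 < n)%N -> 0 < q -> pos_solution q u -> 0 < rho -> 0 < M ->
  (forall x, enorm x <= rho -> u x <= M) ->
  rho ^+ 6 <= 128 * n%:R ^+ 3 * (6 * n * n)%:R ^+ 6 * M `^ (q + 1).
Proof.
move=> n0 q0 [cu [u0 Eu]] rho0 M0 uM.
pose k : R := (6 * n * n)%:R.
have k0 : 0 < k by rewrite ltr0n !muln_gt0 n0.
have Mq : 0 < M `^ q by rewrite powR_gt0.
have inb (x : 'rV[R]_n) : `|x| <= (6 * n)%:R * (rho / k) -> enorm x <= rho.
  move=> xK; rewrite (le_trans (enorm_le_norm x)) //.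
  rewrite (le_trans (ler_wpM2l (ler0n _ _) xK)) //.
  have n1 : n%:R != 0 :> R by rewrite pnatr_eq0 -lt0n.
  by rewrite le_eqVlt /k !natrM; apply/orP; left; apply/eqP; field.
have := @laplacian3_le R n u (rho / k) M (M `^ q)^-1 n0 cu
  (divr_gt0 rho0 k0).
rewrite invr_gt0 => /(_ Mq) H.
have {}H : (rho / k) ^+ 6 / M `^ q <= 128 * n%:R ^+ 3 * M.
  apply: H => x /inb xr; first by rewrite gtr0_norm // uM.
  rewrite Eu powRN lef_pV2 ?posrE ?powR_gt0 //.
  by apply: ge0_ler_powR; rewrite ?nnegrE ?uM // ltW.
rewrite ler_pdivrMr // exprMn exprVn ler_pdivrMr ?exprn_gt0 // in H.
apply: (le_trans H); rewrite powRD; last by rewrite (gt_eqF M0) implybT.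
rewrite (powRr1 (ltW M0)) /k le_eqVlt; apply/orP; left; apply/eqP; ring.
Qed.

Lemma solution_not_small {R : realType} {n : nat} (q : R) (u : 'rV[R]_n -> R) :
  (0 < n)%N -> 0 < q -> pos_solution q u ->
  ~ (forall eps, 0 < eps -> exists2 rho, 0 < rho &
       forall x, enorm x <= rho -> u x <= eps * rho `^ (6 / (q + 1))).
Proof.
move=> n0 q0 su small.
pose c : R := 128 * n%:R ^+ 3 * (6 * n * n)%:R ^+ 6.
have c0 : 0 < c by rewrite !mulr_gt0 ?exprn_gt0 ?ltr0n // !muln_gt0 n0.
have q1 : 0 < q + 1 by rewrite addr_gt0.
have c2 : 0 < (2 * c)^-1 by rewrite invr_gt0 mulr_gt0.
(* With this value the growth bound reads [rho ^+ 6 <= rho ^+ 6 / 2]. *)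
pose eps := (2 * c)^-1 `^ (q + 1)^-1.
have eps0 : 0 < eps by rewrite powR_gt0.
have [rho rho0 us] := small _ eps0.
have M0 : 0 < eps * rho `^ (6 / (q + 1)) by rewrite mulr_gt0 // powR_gt0.
have := @solution_growth R n q u rho _ n0 q0 su rho0 M0 us; rewrite -/c.
rewrite powRM ?powR_ge0 // -!powRrM mulVf ?gt_eqF // divfK ?gt_eqF //.
rewrite (powRr1 (ltW c2)) (powR_mulrn _ (ltW rho0)).
have -> : c * ((2 * c)^-1 * rho ^+ 6) = rho ^+ 6 / 2.
  by field; rewrite gt_eqF.
move=> H.
have r6 : 0 < rho ^+ 6 by rewrite exprn_gt0.
by move: H r6; lra.
Qed.

(** Far out the decay hypothesis applies and the power is monotone; near the origin [u] is bounded
    by compactness, and a large [rho] absorbs that bound. *)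
Lemma little_o_small {R : realType} {n : nat} (a : R) (u : 'rV[R]_n -> R) :
  0 < a -> continuous u -> little_o_pow a u ->
  forall eps, 0 < eps -> exists2 rho, 0 < rho &
    forall x, enorm x <= rho -> u x <= eps * rho `^ a.
Proof.
move=> a0 cu lo eps eps0; have [M0 uM0] := lo eps eps0.
pose K := Num.max M0 0.
have [||c _ cmax] := @EVT_max_rV R n u [set x | `|x| <= K] _ (compact_norm_le n K).
- by exists 0; rewrite /= normr0 le_max lexx orbT.
- exact: continuous_subspaceT.
(* Chosen so that [eps] times the power [a] of [t] is the absolute value of [u c], the maximum over
   the compact ball. *)
pose t := (`|u c| / eps) `^ a^-1.
exists (1 + t) => [|x xr]; first by rewrite ltr_wpDr // powR_ge0.
have t0 : 0 <= t by rewrite powR_ge0.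
have [xM|Mx] := leP (enorm x) M0.
  have /cmax xc : x \in [set x | `|x| <= K].
    by rewrite inE /= le_max (le_trans (norm_le_enorm x)).
  rewrite (le_trans xc) // (le_trans (ler_norm _)) // mulrC -ler_pdivrMr //.
  have -> : `|u c| / eps = t `^ a.
    by rewrite -powRrM mulVf ?gt_eqF // powRr1 // divr_ge0 // ltW.
  by apply: ge0_ler_powR; rewrite ?nnegrE ?addr_ge0 ?lerDr // ltW.
rewrite (le_trans (ler_norm _)) // (le_trans (uM0 x Mx)) // ler_pM2l //.
by apply: ge0_ler_powR; rewrite ?nnegrE ?enorm_ge0 ?addr_ge0 // ltW.
Qed.

(** * Radial functions *)

(** The profile is read off along a coordinate axis and so is defined for negative [r] too; it
    inherits the regularity of [f], and its derivative is [ray i (partial i f)]. *)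
Definition ray {R : realType} {n : nat} (i : 'I_n) (f : 'rV[R]_n -> R) (r : R) : R :=
  f (r *: evec R i).

Definition radial {R : realType} {n : nat} (i : 'I_n) (f : 'rV[R]_n -> R) : Prop :=
  forall x, f x = ray i f (enorm x).

Lemma enorm_eq0 {R : realType} {n : nat} (x : 'rV[R]_n) : enorm x = 0 -> x = 0.
Proof.
move=> x0; apply/eqP; rewrite -normr_eq0 eq_le normr_ge0 andbT -x0.
exact: norm_le_enorm.
Qed.

Lemma enorm_sqr_add {R : realType} {n : nat} (x : 'rV[R]_n) j (s : R) :
  enorm (x + s *: evec R j) ^+ 2 = enorm x ^+ 2 + (2 * x 0 j * s + s ^+ 2).
Proof.
rewrite !enorm_sqr (bigD1 j) //= [in RHS](bigD1 j) //=.
rewrite !mxE !eqxx mulr1 (eq_bigr (fun i => x 0 i ^+ 2)); first by ring.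
by move=> i ij; rewrite !mxE (negPf ij) andbF mulr0 addr0.
Qed.

Lemma enorm_ray {R : realType} {n : nat} (i : 'I_n) (r : R) : 0 <= r ->
  enorm (r *: evec R i) = r.
Proof.
move=> r0; apply/eqP; rewrite -(eqrXn2 (ltn0Sn 1)) ?enorm_ge0 //.
rewrite -[r *: _]add0r enorm_sqr_add enorm_sqr big1 => [|j _].
  by rewrite mxE mulr0 mul0r !add0r.
by rewrite mxE expr0n.
Qed.

Lemma is_derive_enorm {R : realType} {n : nat} (x : 'rV[R]_n) j :
  enorm x != 0 ->
  is_derive (0 : R) 1 (fun s => enorm (x + s *: evec R j)) (x 0 j / enorm x).
Proof.
move=> x0; have xgt : 0 < enorm x by rewrite lt_neqAle eq_sym x0 enorm_ge0.
have -> : (fun s : R => enorm (x + s *: evec R j)) =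
    @Num.sqrt R \o (fun s : R => enorm x ^+ 2 + (2 * x 0 j * s + s ^+ 2)).
  by apply/funext => s /=; rewrite -enorm_sqr_add sqrtr_sqr ger0_norm // enorm_ge0.
have dp : is_derive (0 : R) 1
    (fun s : R => enorm x ^+ 2 + (2 * x 0 j * s + s ^+ 2)) (2 * x 0 j).
  apply: is_derive_eq.
  by rewrite ![_%:A]mulr1; ring.
set p := (fun s : R => _) in dp *.
have ds : is_derive (p 0) 1 (@Num.sqrt R) (2 * enorm x)^-1.
  have -> : p 0 = enorm x ^+ 2 by rewrite /p mulr0 expr0n /= !addr0.
  rewrite -[X in (2 * X)^-1](ger0_norm (ltW xgt)) -sqrtr_sqr.
  by apply: is_derive1_sqrt; rewrite exprn_gt0.
have -> : x 0 j / enorm x = (2 * enorm x)^-1 * (2 * x 0 j) by field.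
exact: (@is_derive1_comp R _ p 0 _ _ ds dp).
Qed.

Lemma is_derive_unique {R : realType} {f : R -> R} {x a b : R} :
  is_derive x 1 f a -> is_derive x 1 f b -> a = b.
Proof. by move=> [_ <-] [_ <-]. Qed.

Lemma is_derive_ray {R : realType} {n : nat} (i : 'I_n) (f : 'rV[R]_n -> R) :
  (forall x, derivable f x (evec R i)) ->
  forall r : R, is_derive r 1 (ray i f) (ray i (partial i f) r).
Proof.
move=> df r; have := is_derive_partial i f df 0 r; rewrite add0r.
by under eq_fun do rewrite add0r.
Qed.

Lemma is_derive_ray_enorm {R : realType} {n : nat} (i j : 'I_n)
    (f : 'rV[R]_n -> R) (x : 'rV[R]_n) :
  (forall y, derivable f y (evec R i)) -> enorm x != 0 ->
  is_derive (0 : R) 1 (fun s => ray i f (enorm (x + s *: evec R j)))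
    (ray i (partial i f) (enorm x) * (x 0 j / enorm x)).
Proof.
move=> df x0; pose g (s : R) := enorm (x + s *: evec R j).
have g0 : g 0 = enorm x by rewrite /g scale0r addr0.
apply: (@is_derive1_comp R (ray i f) g 0); last exact: is_derive_enorm.
by rewrite g0; apply: is_derive_ray.
Qed.

(* Multiplying by [enorm x] makes the identity hold at [x = 0] too, so that it can
   be differentiated without localisation. *)
Lemma radial_partial {R : realType} {n : nat} (i j : 'I_n) (f : 'rV[R]_n -> R) x :
  Ck 1 f -> radial i f ->
  enorm x * partial j f x = ray i (partial i f) (enorm x) * x 0 j.
Proof.
move=> cf rf; have [x0|x0] := eqVneq (enorm x) 0.
  by rewrite x0 mul0r (enorm_eq0 x x0) mxE mulr0.
have d1 := is_derive_partial j f (Ck_derivable cf j) x 0.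
have d2 := is_derive_ray_enorm i j f x (Ck_derivable cf i) x0.
have E : (fun s : R => f (x + s *: evec R j)) =
    (fun s => ray i f (enorm (x + s *: evec R j))).
  by apply/funext => s; rewrite -rf.
rewrite E scale0r addr0 in d1; rewrite (is_derive_unique d1 d2).
by field.
Qed.

(** Obtained by differentiating the identity of [radial_partial] in direction [j] with the product
    rule. *)
Lemma radial_partial2 {R : realType} {n : nat} (i j : 'I_n) (f : 'rV[R]_n -> R) x :
  Ck 2 f -> radial i f -> enorm x != 0 ->
  enorm x * partial j (partial j f) x =
  ray i (partial i f) (enorm x) +
  (ray i (partial i (partial i f)) (enorm x) / enorm x -
   ray i (partial i f) (enorm x) / enorm x ^+ 2) * x 0 j ^+ 2.
Proof.
move=> cf rf x0.
have c1 k : forall y, derivable (partial k f) y (evec R k).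
  exact: Ck_derivable (Ck_partial cf k) k.
have de := is_derive_enorm x j x0.
have dp := is_derive_partial j (partial j f) (c1 j) x 0.
have dr := is_derive_ray_enorm i j (partial i f) x (c1 i) x0.
have dx : is_derive (0 : R) 1 (fun s : R => s + x 0 j) 1.
  exact: is_derive_shift.
have dl := is_deriveM de dp.
have dR := is_deriveM dr dx.
(* The first-order identity holds on the entire line, even through the origin, so the two products
   agree as functions of [s]. *)
have E : (fun s : R => enorm (x + s *: evec R j)) *
    (fun s : R => partial j f (x + s *: evec R j)) =
    (fun s : R => ray i (partial i f) (enorm (x + s *: evec R j))) *
    (fun s : R => s + x 0 j).
  apply/funext => s; set y := x + s *: evec R j.
  change (enorm y * partial j f y = ray i (partial i f) (enorm y) * (s + x 0 j)).
  rewrite (radial_partial i j f y (CkW cf) rf).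
  by rewrite !mxE !eqxx /= mulr1 addrC.
rewrite E in dl; have := is_derive_unique dl dR.
rewrite !scale0r !addr0 add0r /GRing.scale /= mulr1.
have := radial_partial i j f x (CkW cf) rf.
set a := partial j f x; set b := ray i (partial i f) _ => ab.
have -> : a = b * x 0 j / enorm x by rewrite -ab mulrAC divff // mul1r.
move=> /(canRL (addrK _)) ->.
by field.
Qed.

(** The classical formula [f'' + (n - 1) f' / r], multiplied by [r]; the squares [x 0 j ^+ 2] add up
    to [enorm x ^+ 2]. *)
Lemma radial_laplacian_eq {R : realType} {n : nat} (i : 'I_n) (f : 'rV[R]_n -> R) x :
  Ck 2 f -> radial i f -> enorm x != 0 ->
  enorm x * laplacian f x = enorm x * ray i (partial i (partial i f)) (enorm x)
    + n.-1%:R * ray i (partial i f) (enorm x).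
Proof.
move=> cf rf x0; rewrite /laplacian mulr_sumr.
under eq_bigr do rewrite (radial_partial2 i) //.
rewrite big_split /= sumr_const card_ord -mulr_sumr -enorm_sqr.
have n0 : (0 < n)%N by apply: leq_ltn_trans (ltn_ord i).
have -> : n.-1%:R = n%:R - 1 :> R by rewrite -{2}(prednK n0) -natr1 addrK.
by rewrite -mulr_natl; field.
Qed.

Lemma radial_laplacian {R : realType} {n : nat} (i : 'I_n) (f : 'rV[R]_n -> R) :
  Ck 2 f -> radial i f -> radial i (laplacian f).
Proof.
move=> cf rf x; have [x0|x0] := eqVneq (enorm x) 0.
  by rewrite /ray x0 scale0r (enorm_eq0 x x0).
have ex := enorm_ray i (enorm x) (enorm_ge0 x).
have e1 := radial_laplacian_eq i f x cf rf x0.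
have e2 := radial_laplacian_eq i f (enorm x *: evec R i) cf rf.
rewrite ex in e2; apply: (mulfI x0); exact: etrans e1 (esym (e2 x0)).
Qed.

(* [r^(n-1) f'(r)] has derivative [r^(n-1) Lap f(r)]. *)
Lemma radial_flux_ge {R : realType} {n : nat} (i : 'I_n) (f : 'rV[R]_n -> R)
    (a b c : R) :
  (2 <= n)%N -> Ck 2 f -> radial i f -> 0 <= a -> a < b ->
  (forall r, a < r -> c <= ray i (laplacian f) r) ->
  a ^+ n.-1 * ray i (partial i f) a + c / n%:R * (b ^+ n - a ^+ n) <=
  b ^+ n.-1 * ray i (partial i f) b.
Proof.
move=> n2 cf rf a0 ab cl.
have n0 : n%:R != 0 :> R by rewrite pnatr_eq0; case: (n) n2.
set p := ray i (partial i f).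
have dp (r : R) : is_derive r 1 p (ray i (partial i (partial i f)) r).
  apply: is_derive_ray; exact: Ck_derivable (Ck_partial cf i) i.
(* Subtracting a primitive of [c * r ^+ n.-1] reduces the claim to monotonicity of [G], whose
   derivative is [r ^+ n.-1] times [ray i (laplacian f) r - c]. *)
pose G (r : R) := r ^+ n.-1 * p r - c / n%:R * r ^+ n.
pose dG (r : R) := r ^+ n.-1 * ray i (partial i (partial i f)) r +
  p r * (n.-1%:R * r ^+ n.-2) - c * r ^+ n.-1.
have dGP (r : R) : is_derive r 1 G (dG r).
  rewrite /G /dG.
  have dX m : is_derive r 1 (fun s : R => s ^+ m) (m%:R * r ^+ m.-1).
    split; first exact: exprn_derivable.
    by rewrite exp_derive [LHS]mulr1.
  apply: is_deriveB.
    exact: is_deriveM (dX n.-1) (dp r).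
  have -> : c * r ^+ n.-1 = c / n%:R *: (n%:R * r ^+ n.-1).
    by rewrite /GRing.scale /=; field.
  exact: is_deriveZ.
have [r /andP[ar rb] E] := MVT_global G dG a b ab dGP.
have r0 : 0 < r by apply: le_lt_trans ar.
have dG0 : 0 <= dG r.
  have := radial_laplacian_eq i f (r *: evec R i) cf rf.
  rewrite enorm_ray ?(ltW r0) // => /(_ (lt0r_neq0 r0)) L.
  have -> : dG r = r ^+ n.-1 * (ray i (laplacian f) r - c).
    suff: r * dG r = r * (r ^+ n.-1 * (ray i (laplacian f) r - c)).
      exact: (mulfI (lt0r_neq0 r0)).
    have {}L : r * ray i (laplacian f) r =
      r * ray i (partial i (partial i f)) r + n.-1%:R * p r := L.
    rewrite [RHS]mulrCA [in RHS]mulrBr L /dG.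
    have -> : r ^+ n.-1 = r * r ^+ n.-2.
      by rewrite -exprS; case: (n) n2 => [|[]].
    by ring.
  by rewrite mulr_ge0 ?exprn_ge0 ?(ltW r0) // subr_ge0 cl.
have : 0 <= G b - G a by rewrite E mulr_ge0 // subr_ge0 ltW.
by rewrite /G; lra.
Qed.

Lemma ray_ge {R : realType} {n : nat} (i : 'I_n) (f : 'rV[R]_n -> R) (a b c : R) :
  Ck 1 f -> a <= b -> (forall r, a < r -> c <= ray i (partial i f) r) ->
  ray i f a + c * (b - a) <= ray i f b.
Proof.
move=> cf; rewrite le_eqVlt => /predU1P[->|ab] cp; first by rewrite subrr mulr0 addr0.
have [r /andP[ar _] E] := MVT_global _ _ _ _ ab (is_derive_ray i f (Ck_derivable cf i)).
rewrite -lerBrDl E ler_pM2r ?subr_gt0 //; exact: cp.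
Qed.

(** The flux starts from 0 at the origin, as [n.-1] is positive, and does not decrease; hence the
    radial derivative is nonnegative. *)
Lemma radial_subharmonic_incr {R : realType} {n : nat} (i : 'I_n)
    (f : 'rV[R]_n -> R) (a b : R) :
  (2 <= n)%N -> Ck 2 f -> radial i f -> 0 <= a -> a <= b ->
  (forall r, 0 < r -> 0 <= ray i (laplacian f) r) ->
  ray i f a <= ray i f b.
Proof.
move=> n2 cf rf a0 ab cl.
have := @ray_ge R n i f a b 0 (CkW cf) ab; rewrite mul0r addr0; apply => r ar.
have r0 : 0 < r by apply: le_lt_trans ar.
have := radial_flux_ge i f 0 r 0 n2 cf rf (lexx 0) r0 cl.
rewrite !mul0r addr0 expr0n; have -> : (n.-1 == 0)%N = false by case: (n) n2 => [|[]].
by rewrite mul0r pmulr_rge0 // exprn_gt0.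
Qed.

(** The flux grows at least like [c / n] times [r ^+ n], up to a constant, so the radial derivative
    is eventually at least 1. *)
Lemma radial_growth {R : realType} {n : nat} (i : 'I_n)
    (f : 'rV[R]_n -> R) (a c A : R) :
  (2 <= n)%N -> Ck 2 f -> radial i f -> 0 <= a -> 0 < c ->
  (forall r, a < r -> c <= ray i (laplacian f) r) ->
  exists b, [/\ a < b, forall r, b <= r -> A <= ray i f r &
    forall r s, b <= r -> r <= s -> ray i f r <= ray i f s].
Proof.
move=> n2 cf rf a0 c0 cl.
have n0 : 0 < n%:R :> R by rewrite ltr0n; case: (n) n2.
pose d := c / n%:R; have d0 : 0 < d by rewrite divr_gt0.
pose K := `|d * a ^+ n - a ^+ n.-1 * ray i (partial i f) a|.
(* Beyond [b0] one has [d * r >= K + 1] and [r >= 1], so [r ^+ n.-1 * (d * r) - K] is at least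
   [r ^+ n.-1], which gives slope 1. *)
pose b0 := a + 1 + (K + 1) / d.
have K0 : 0 <= K by exact: normr_ge0.
have kd0 : 0 < (K + 1) / d by rewrite divr_gt0 // ltr_wpDl.
have p1 r : b0 < r -> 1 <= ray i (partial i f) r.
  move=> br.
  have ar : a < r by move: br; rewrite /b0; lra.
  have r1 : 1 <= r by move: br; rewrite /b0; lra.
  have dr : K + 1 <= d * r.
    by rewrite mulrC -ler_pdivrMr //; move: br; rewrite /b0; lra.
  have r0 : 0 < r by apply: lt_le_trans r1.
  have rn : 0 < r ^+ n.-1 by rewrite exprn_gt0.
  rewrite -(ler_pM2l rn) mulr1.
  apply: le_trans (radial_flux_ge i f a r c n2 cf rf a0 ar cl); rewrite -/d.
  have -> : r ^+ n = r ^+ n.-1 * r by rewrite -exprSr prednK //; case: (n) n2.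
  have rn1 : 1 <= r ^+ n.-1 by apply: exprn_ege1.
  have KP : d * a ^+ n - a ^+ n.-1 * ray i (partial i f) a <= K by exact: ler_norm.
  have : 0 <= r ^+ n.-1 * (d * r - K - 1) by rewrite mulr_ge0 ?(ltW rn) //; lra.
  have : 0 <= K * (r ^+ n.-1 - 1) by rewrite mulr_ge0 // subr_ge0.
  by lra.
pose b := b0 + `|A - ray i f b0|.
have bb0 : b0 <= b by rewrite lerDl.
exists b; split => [|r br|r s br rs].
- by rewrite (lt_le_trans _ bb0) // /b0; lra.
- have := @ray_ge R n i f b0 r 1 (CkW cf) (le_trans bb0 br) p1.
  apply: le_trans; rewrite mul1r.
  by have := ler_norm (A - ray i f b0); move: br; rewrite /b; lra.
- have := @ray_ge R n i f r s 0 (CkW cf) rs; rewrite mul0r addr0; apply => t rt.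
  rewrite (le_trans ler01) // p1 //.
  by apply: le_lt_trans rt; exact: le_trans br.
Qed.

(** * Change of sign, and maxima of radial solutions on balls *)

Lemma CkN {R : realType} {n k : nat} {f : 'rV[R]_n -> R} : Ck k f -> Ck k (- f).
Proof.
have cN (g : 'rV[R]_n -> R) : continuous g -> continuous (- g).
  by move=> cg x; apply: continuousN; apply: cg.
elim: k f => [|k ih] f cf; first exact: cN.
split; first exact: cN (Ck_continuous cf).
split => [i x|i]; first by apply: derivableN; exact: Ck_derivable cf i x.
have -> : partial i (- f) = - partial i f.
  by apply/funext => x; rewrite /partial deriveN //; exact: Ck_derivable cf i x.
by apply: ih; apply: Ck_partial.
Qed.

Lemma laplacianN {R : realType} {n : nat} {f : 'rV[R]_n -> R} :
  Ck 2 f -> laplacian (- f) = - laplacian f.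
Proof.
have pN i (g : 'rV[R]_n -> R) : Ck 1 g -> partial i (- g) = - partial i g.
  move=> cg; apply/funext => x; rewrite /partial deriveN //.
  exact: Ck_derivable cg i x.
move=> cf; apply/funext => x; rewrite /laplacian [RHS]/GRing.opp /= -sumrN.
apply: eq_bigr => i _; rewrite (pN i f) ?(pN i (partial i f)) //.
  exact: Ck_partial.
exact: CkW.
Qed.

Lemma radialN {R : realType} {n : nat} {i : 'I_n} {f : 'rV[R]_n -> R} :
  radial i f -> radial i (- f).
Proof. by move=> rf x; congr (- _); apply: rf. Qed.

Lemma radial_solution_eventually_max {R : realType} {n : nat} (i : 'I_n)
    (u : 'rV[R]_n -> R) :
  (2 <= n)%N -> Ck 6 u -> (forall x, 0 < u x) -> radial i u ->
  (forall x, 0 <= laplacian (laplacian (laplacian u)) x) ->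
  exists b, forall r x, b <= r -> enorm x <= r -> u x <= ray i u r.
Proof.
move=> n2 cu u0 ru L3.
have c4 : Ck 4 (laplacian u) := Ck_laplacian cu.
have c2 : Ck 2 (laplacian (laplacian u)) := Ck_laplacian c4.
have cv : Ck 2 (laplacian u) := CkW (CkW c4).
have cu2 : Ck 2 u := CkW (CkW (CkW (CkW cu))).
have rv := radial_laplacian i u cu2 ru.
have rw := radial_laplacian i _ cv rv.
have Wincr a b : 0 <= a -> a <= b ->
    ray i (laplacian (laplacian u)) a <= ray i (laplacian (laplacian u)) b.
  move=> a0 ab.
  exact: (radial_subharmonic_incr i _ a b n2 c2 rw a0 ab (fun r _ => L3 _)).
have [[a a0 Wa]|Wneg] := pselect (exists2 a, 0 <= a &
    0 < ray i (laplacian (laplacian u)) a).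
  have [b1 [ab1 V1 _]] := @radial_growth R n i (laplacian u) a _ 1 n2 cv rv a0 Wa
    (fun r ar => Wincr a r a0 (ltW ar)).
  have b10 : 0 <= b1 by rewrite (le_trans a0) // ltW.
  have gr A := @radial_growth R n i u b1 1 A n2 cu2 ru b10 ltr01
    (fun r br => V1 r (ltW br)).
  have [b2 [b12 _ incr]] := gr 0.
  (* Past [b2] the profile is monotone. The sup-norm ball of radius [b2] contains the Euclidean one,
     and past [b3] the profile exceeds the maximum [u z] over it. *)
  have [||z _ zmax] := @EVT_max_rV R n u [set x | `|x| <= b2] _ (compact_norm_le n b2).
  - by exists 0; rewrite /= normr0 (le_trans b10) // ltW.
  - by apply: continuous_subspaceT; exact: Ck_continuous cu.
  have [b3 [_ uz _]] := gr (u z).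
  exists (Num.max b2 b3) => r x; rewrite ge_max => /andP[b2r b3r] xr.
  have [xb|/ltW bx] := leP (enorm x) b2.
    apply: le_trans (uz r b3r); apply: zmax.
    by rewrite inE /= (le_trans (norm_le_enorm x)).
  by rewrite ru; exact: incr.
have Wle r : 0 <= r -> ray i (laplacian (laplacian u)) r <= 0.
  by move=> r0; rewrite leNgt; apply/negP => Wr; apply: Wneg; exists r.
have Vdecr a b : 0 <= a -> a <= b -> ray i (laplacian u) b <= ray i (laplacian u) a.
  move=> a0 ab; rewrite -lerN2.
  apply: (@radial_subharmonic_incr R n i (- laplacian u) a b n2 (CkN cv)
    (radialN rv) a0 ab) => r r0.
  by rewrite (laplacianN cv) /ray oppr_ge0; apply: Wle; exact: ltW.
(* A negative value would persist at larger radii, so [- u] would have Laplacian bounded below by a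
   positive constant there and would become nonnegative, against [u > 0]. *)
have Vge r : 0 <= r -> 0 <= ray i (laplacian u) r.
  move=> r0; rewrite leNgt; apply/negP => Vr.
  have nc : 0 < - ray i (laplacian u) r by rewrite oppr_gt0.
  have [|b [_ ub _]] := @radial_growth R n i (- u) r _ 0 n2 (CkN cu2)
      (radialN ru) r0 nc.
    move=> s rs; rewrite (laplacianN cu2) /ray lerN2.
    by apply: Vdecr => //; exact: ltW.
  have := ub b (lexx b); rewrite /ray oppr_ge0.
  by rewrite leNgt => /negP; apply; exact: u0.
exists 0 => r x r0 xr; rewrite ru.
exact: (radial_subharmonic_incr i u _ _ n2 cu2 ru (enorm_ge0 x) xr
  (fun s s0 => Vge s (ltW s0))).
Qed.

(** The lower limit is a supremum of infima over neighbourhoods of infinity; if [g] stayed above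
    [eps] beyond [b], that half-line alone would force it to be at least [eps]. *)
Lemma limf_einf_eq0_pinfty {R : realType} (g : R -> R) (eps b : R) :
  limf_einf (fun r : R => (g r)%:E) (pinfty_nbhs R) = 0%E -> 0 < eps ->
  exists2 r, b < r & g r < eps.
Proof.
rewrite limf_einfE => S0 eps0; apply: contrapT => none.
have ge r : b < r -> eps <= g r.
  by move=> br; rewrite leNgt; apply/negP => gr; apply: none; exists r.
pose V := [set r : R | b < r].
have : (eps%:E <= 0)%E.
  rewrite -S0; apply: (@le_trans _ _ (ereal_inf ((fun r : R => (g r)%:E) @` V))).
    by apply: le_ereal_inf_tmp => _ [r br <-]; rewrite lee_fin; exact: ge.
  apply: ereal_sup_ubound; exists V => //.
  by exists b; split => //; exact: num_real.
by rewrite lee_fin leNgt eps0.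
Qed.

Theorem mainTheorem7 (R : realType) (n : nat) (q : R) :
  (2 <= n)%N -> 0 < q ->
  (~ exists u : 'rV[R]_n -> R,
       pos_solution q u /\ little_o_pow (6 / (q + 1)) u) /\
  (~ exists (u : 'rV[R]_n -> R) (phi : R -> R),
       pos_solution q u /\ radial_profile u phi /\
       (limf_esup (fun r : R => ((phi r / r `^ (6 / (q + 1)))%:E))
                  (pinfty_nbhs R) < +oo)%E /\
       limf_einf (fun r : R => ((phi r / r `^ (6 / (q + 1)))%:E))
                  (pinfty_nbhs R) = 0%E).
Proof.
move=> n2 q0.
have n0 : (0 < n)%N by apply: leq_trans n2.
split=> [[u [su lo]]|[u [phi [su [pu [_ linf]]]]]];
  apply: (solution_not_small q u n0 q0 su).
  apply: little_o_small => //; first by rewrite divr_gt0 // addr_gt0.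
  by case: su => cu _; exact: Ck_continuous cu.
move=> eps eps0; have [cu [u0 Eu]] := su.
pose i := Ordinal n0.
have ru : radial i u.
  by move=> x; rewrite /ray !pu enorm_ray // enorm_ge0.
have [|b ub] := radial_solution_eventually_max i u n2 cu u0 ru.
  by move=> x; rewrite Eu powR_ge0.
(* The maximum with 0 makes [r] positive, so that the quotient can be multiplied out. *)
have [r br gr] := limf_einf_eq0_pinfty _ eps (Num.max b 0) linf eps0.
move: br; rewrite gt_max => /andP[br r0].
exists r => // x xr; apply: (le_trans (ub r x (ltW br) xr)).
rewrite /ray pu enorm_ray ?(ltW r0) // -ler_pdivrMr ?powR_gt0 //.
exact: ltW.
Qed.
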